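(* Let $\alpha\in(0,2)$ and $\beta\in(0,1)$. The process $\mathbb{U}^{\alpha,\beta}=(\mathbb{U}^{\alpha,\beta}_t)_{t\ge0}$ defined in the context is $(\beta/\alpha)$-self-similar; that is, for all $\lambda>0$, the processes $$\left(\mathbb{U}^{\alpha,\beta}_{\lambda t}\right)_{t\ge0}\quad\text{and}\quad\lambda^{\beta/\alpha}\left(\mathbb{U}^{\alpha,\beta}_t\right)_{t\ge0}$$ have the same finite-dimensional distributions.
   Context: Let $(\Omega',\mathcal F',\mathbb P')$ be a probability space carrying a standard (unit rate) Poisson process $N'=(N'(t))_{t\ge0}$. Let $\mathcal M_{\alpha,\beta}$ be a symmetric $\alpha$-stable (S$\alpha$S) random measure on $\mathbb{R}_+\times\Omega'$ with control measure $\beta r^{-\beta-1}dr\,\mathbb P'(d\omega')$, defined on some probability space $(\Omega,\mathcal F,\mathbb P)$, and $$\mathbb{U}^{\alpha,\beta}_t=\int_{\mathbb{R}_+\times\Omega'}\mathbf 1_{\{N'(tr)(\omega')\text{ odd}\}}\,\mathcal M_{\alpha,\beta}(dr,d\omega'),\quad t\ge0.$$ Normalization: for $f\in L^\alpha$ of the control measure $m$, $\mathbb{E}\exp(i\theta\int f\,d\mathcal M_{\alpha,\beta})=\exp(-|\theta|^\alpha\int|f|^\alpha dm)$, and the stochastic integral is linear in $f$. *)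

(* Defs.v *)
From HB Require Import structures.
From mathcomp Require Import all_boot all_order all_algebra.
From mathcomp Require Import all_classical all_reals all_analysis.
From mathcomp Require Import measurable_realfun complex.

Set Implicit Arguments.
Unset Strict Implicit.
Unset Printing Implicit Defensive.

Import Order.TTheory GRing.Theory Num.Theory.
Import numFieldNormedType.Exports.

Local Open Scope classical_set_scope.
Local Open Scope ring_scope.

Section probability_notions.
Context d (T : measurableType d) (R : realType) (P : probability T R).

(* Requiring the product rule for all measurable sets (including [setT]) covers
   all subfamilies. *)
Definition mutually_independent d' (T' : measurableType d') (n : nat)
    (X : 'I_n -> T -> T') : Prop :=
  forall B : 'I_n -> set T', (forall i, measurable (B i)) ->
    P (\bigcap_i (X i @^-1` B i)) = (\prod_(i < n) P (X i @^-1` B i))%E.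

(* [E exp(i theta X)], split into its real and imaginary parts since the library
   integrates real-valued functions only. *)
Definition char_fun (X : T -> R) (theta : R) : R[i] :=
  ((\int[P]_w cos (theta * X w)) +i* (\int[P]_w sin (theta * X w)))%C.

Definition same_fdd (X Y : R -> T -> R) : Prop :=
  forall (n : nat) (t : 'I_n -> R), (forall i, 0 <= t i) ->
  forall B : set (n.-tuple R), measurable B ->
    pushforward P (fun w => [tuple X (t i) w | i < n]) B =
    pushforward P (fun w => [tuple Y (t i) w | i < n]) B.

Definition self_similar (H : R) (X : R -> T -> R) : Prop :=
  forall lambda : R, 0 < lambda ->
    same_fdd (fun t => X (lambda * t)) (fun t w => lambda `^ H * X t w).

(* Only the restriction of [N] to nonnegative times is constrained. *)
Record standard_Poisson_process (N : R -> {RV P >-> nat}) : Prop := {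
  Poisson_start : forall w, N 0 w = 0%N ;
  Poisson_nondecreasing : forall (s t : R) w, 0 <= s -> s <= t ->
    (N s w <= N t w)%N ;
  Poisson_right_continuous : forall (t : R) w, 0 <= t ->
    N s w @[s --> t^'+] --> N t w ;
  Poisson_increments : forall (s t : R) (k : nat), 0 <= s -> s < t ->
    P [set w | (N t w - N s w)%N = k] = (poisson_pmf (t - s) k)%:E ;
  Poisson_independent_increments : forall (n : nat) (t : nat -> R),
    0 <= t 0%N -> {homo t : i j / (i <= j)%N >-> i <= j} ->
    @mutually_independent _ nat n
      (fun i w => (N (t i.+1) w - N (t i) w)%N) }.

End probability_notions.

Section control_measure.
Context (R : realType) (beta : R) (beta_gt0 : 0 < beta).

(* The positivity proof is an argument so that the measure structure below can
   be inferred. *)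
Definition radial_measure of 0 < beta := fun A : set R =>
  (\int[lebesgue_measure]_(r in A `&` `]0%R, +oo[) (beta * r `^ (- beta - 1))%:E)%E.

Local Notation radial := (radial_measure beta_gt0).

Let radial0 : radial set0 = 0%E.
Proof. by rewrite /radial_measure set0I integral_set0. Qed.

Let radial_ge0 A : (0 <= radial A)%E.
Proof.
apply: integral_ge0 => r _.
by rewrite lee_fin mulr_ge0 ?powR_ge0// ltW.
Qed.

Let radial_sigma_additive : semi_sigma_additive radial.
Proof.
move=> F mF tF mUF; rewrite /radial_measure; apply: cvg_toP.
  apply: ereal_nondecreasing_is_cvgn => m n mn.
  by apply: lee_sum_nneg_natr => // k _ _; exact: radial_ge0.
rewrite setI_bigcupl ge0_integral_bigcup//=.
- by move=> k; apply: measurableI; [exact: mF|exact: measurable_itv].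
- apply/measurable_EFinP/measurable_funTS; exact: measurable_funM.
- by move=> x _; rewrite lee_fin mulr_ge0 ?powR_ge0// ltW.
- exact: trivIset_setIr tF.
Qed.

HB.instance Definition _ := isMeasure.Build _ _ _ radial
  radial0 radial_ge0 radial_sigma_additive.

End control_measure.

(* [R_+ x T'] is represented by [R * T'] with a measure that does not charge
   [r <= 0]. *)
Definition control_measure d' (T' : measurableType d') (R : realType)
    (P' : probability T' R) (beta : R) (beta_gt0 : 0 < beta)
    : {measure set (R * T') -> \bar R} :=
  (radial_measure beta_gt0 \x P')%E.

Section stable_random_measures.
Context d (T : measurableType d) (R : realType) (P : probability T R).
Context d' (E : measurableType d') (m : {measure set E -> \bar R}) (alpha : R).

(* [M A] is meaningful only for measurable [A] with [m A < +oo]. *)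
Record SaS_random_measure (M : set E -> {RV P >-> R}) : Prop := {
  SaS_law : forall A, measurable A -> (m A < +oo)%E -> forall theta : R,
    char_fun P (M A) theta =
    (expR (- (`|theta| `^ alpha * fine (m A))))%:C%C ;
  SaS_independently_scattered : forall (n : nat) (A : 'I_n -> set E),
    (forall i, measurable (A i)) -> (forall i, (m (A i) < +oo)%E) ->
    trivIset setT A ->
    mutually_independent P (fun i => M (A i) : T -> R) ;
  SaS_sigma_additive : forall A : nat -> set E,
    (forall i, measurable (A i)) -> (m (\bigcup_i A i) < +oo)%E ->
    trivIset setT A ->
    {ae P, forall w,
      \sum_(0 <= i < n) M (A i) w @[n --> \oo] --> M (\bigcup_i A i) w} }.

(* [I f] is meaningful only for [f] in [L^alpha(m)]; on that space the clauses
   below determine [I f] up to [P]-null sets. *)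
Record SaS_integral (M : set E -> {RV P >-> R})
    (I : (E -> R) -> {RV P >-> R}) : Prop := {
  SaS_integral_indic : forall A, measurable A -> (m A < +oo)%E ->
    {ae P, forall w, I \1_A w = M A w} ;
  SaS_integral_linear : forall (a b : R) (f g : E -> R),
    f \in Lfun m alpha%:E -> g \in Lfun m alpha%:E ->
    {ae P, forall w,
      I (fun x => a * f x + b * g x) w = a * I f w + b * I g w} ;
  SaS_integral_law : forall f : E -> R, f \in Lfun m alpha%:E ->
    forall theta : R,
    char_fun P (I f) theta =
    (expR (- (`|theta| `^ alpha * \int[m]_x (`|f x| `^ alpha))))%:C%C }.

End stable_random_measures.

(* The constraint [0 <= x.1] keeps [N] evaluated at nonnegative times. *)
Definition odd_occupancy d' (T' : measurableType d') (R : realType)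
    (P' : probability T' R) (N : R -> {RV P' >-> nat}) (t : R)
    : set (R * T') :=
  [set x | 0 <= x.1 /\ odd (N (t * x.1) x.2)].

Definition U_process d' (T' : measurableType d') (R : realType)
    (P' : probability T' R) (N : R -> {RV P' >-> nat})
    d (T : measurableType d) (P : probability T R)
    (I : (R * T' -> R) -> {RV P >-> R}) (t : R) : T -> R :=
  I \1_(odd_occupancy N t).

(* Main.v *)
(* The characteristic function of [\sum_i theta_i U_(t_i)] is
   [exp (- \int `|\sum_i theta_i 1{N'(t_i r) odd}| `^ alpha dm)]. Replacing [t] by
   [lambda t] amounts to substituting [lambda r] for [r], and the control measure
   [beta r^(-beta-1) dr P'(dw)] is homogeneous of degree [beta] under this
   substitution, so the exponent is multiplied by [lambda `^ beta]; this is also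
   the effect of multiplying the process by [lambda `^ (beta / alpha)]. The
   integrands are in [L^alpha] because [P'(N'(r) odd)] is at most [min(1, r)],
   whose integral over dyadic intervals is dominated by two geometric series
   (ratios [2^(beta-1)] near [0] and [2^(-beta)] near infinity).

   Equality of the characteristic functions of all linear combinations yields
   equality of the laws: the class of functions obtained from trigonometric
   polynomials by bounded pointwise limits is an algebra, hence the sets whose
   indicator it contains form a sigma-algebra; it contains the half-spaces
   [x_i > a], because [1{x > a}] is the limit of [1{sin ((x - a) / m) > 0}]. *)
Require Import Defs.
From mathcomp Require Import all_boot all_order all_algebra.
From mathcomp Require Import all_classical all_reals all_analysis.
From mathcomp Require Import measurable_realfun complex.
From mathcomp Require Import ring lra.

Set Implicit Arguments.
Unset Strict Implicit.
Unset Printing Implicit Defensive.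

Import Order.TTheory GRing.Theory Num.Theory.
Import numFieldNormedType.Exports.

Local Open Scope classical_set_scope.
Local Open Scope ring_scope.

(** * Bounded pointwise closure of the trigonometric polynomials *)

Section trig_closure.
Context (R : realType) (n : nat).
Implicit Types (F G : n.-tuple R -> R) (A B : set (n.-tuple R)).

(* The bounded pointwise closure of the trigonometric polynomials: expectations
   of its members depend only on the characteristic function, and it will turn
   out to contain the indicators of all Borel sets. *)
Inductive trig_closure : (n.-tuple R -> R) -> Prop :=
| trig_closure_cos (theta : 'I_n -> R) (phi : R) :
    trig_closure (fun x => cos (\sum_i theta i * tnth x i + phi))
| trig_closure_lin (a b : R) F G : trig_closure F -> trig_closure G ->
    trig_closure (fun x => a * F x + b * G x)
| trig_closure_lim (F_ : nat -> n.-tuple R -> R) F (K : R) :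
    (forall k, trig_closure (F_ k)) -> (forall k x, `|F_ k x| <= K) ->
    (forall x, F_ k x @[k --> \oo] --> F x) -> trig_closure F.

Lemma trig_closure_eq F G : trig_closure F -> F =1 G -> trig_closure G.
Proof. by move=> /[swap] /funext ->. Qed.

Lemma trig_closure_bounded F : trig_closure F ->
  exists K, forall x, `|F x| <= K.
Proof.
elim => {F} [theta phi|a b F G _ [K FK] _ [L GL]|F_ F K _ _ FK cvgF].
- by exists 1 => x; rewrite ler_norml cos_geN1 cos_le1.
- exists (`|a| * K + `|b| * L) => x.
  by rewrite (le_trans (ler_normD _ _))// lerD// normrM ler_wpM2l.
- exists K => x; have cF : `|F_ k x| @[k --> \oo] --> `|F x| by exact: cvg_norm.
  rewrite -(cvg_lim (@norm_hausdorff _ R) cF); apply: limr_le.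
    by apply/cvg_ex; eexists; exact: cF.
  by apply: nearW => k; exact: FK.
Qed.

Lemma trig_closure_cst (c : R) : trig_closure (fun=> c).
Proof.
have /trig_closure_lin/(_ (trig_closure_cos (fun=> 0) 0)) :=
  trig_closure_cos (fun=> 0) 0.
move=> /(_ c 0)/trig_closure_eq; apply => x.
by rewrite big1 ?addr0 ?cos0 ?mulr1 ?mul0r ?addr0// => i _; rewrite mul0r.
Qed.

(** Double induction: the product-to-sum formula settles two cosines, distributivity the
    combinations, and limits pass because the other factor is bounded. *)
Lemma trig_closureM F G : trig_closure F -> trig_closure G ->
  trig_closure (fun x => F x * G x).
Proof.
move=> tF tG; elim: tF => {F} [th1 ph1|a b F F' _ FG _ F'G|F_ F K tF FG FK cvgF].
- elim: tG => {G} [th2 ph2|a b F F' _ FG _ F'G|F_ F K tF FG FK cvgF].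
  + have := trig_closure_lin (2^-1) (2^-1)
      (trig_closure_cos (fun i => th1 i + th2 i) (ph1 + ph2))
      (trig_closure_cos (fun i => th1 i - th2 i) (ph1 - ph2)).
    move=> /trig_closure_eq; apply => x.
    have -> : \sum_i (th1 i + th2 i) * tnth x i + (ph1 + ph2) =
        (\sum_i th1 i * tnth x i + ph1) + (\sum_i th2 i * tnth x i + ph2).
      under eq_bigr do rewrite mulrDl.
      by rewrite big_split/= addrACA.
    have -> : \sum_i (th1 i - th2 i) * tnth x i + (ph1 - ph2) =
        (\sum_i th1 i * tnth x i + ph1) - (\sum_i th2 i * tnth x i + ph2).
      under eq_bigr do rewrite mulrBl.
      by rewrite sumrB opprD addrACA.
    by rewrite cosD cosB; field.
  + apply: (trig_closure_eq (trig_closure_lin a b FG F'G)) => x /=; ring.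
  + apply: (trig_closure_lim FG (K := K)) => [k x|x].
      rewrite normrM -[leRHS]mul1r ler_pM//.
      by rewrite ler_norml cos_geN1 cos_le1.
    by apply: cvgM => //; exact: cvg_cst.
- apply: (trig_closure_eq (trig_closure_lin a b FG F'G)) => x /=; ring.
- have [L GL] := trig_closure_bounded tG.
  apply: (trig_closure_lim FG (K := K * L)) => [k x|x].
    by rewrite normrM ler_pM.
  by apply: cvgM => //; exact: cvg_cst.
Qed.

Lemma trig_closureX F k : trig_closure F -> trig_closure (fun x => F x ^+ k).
Proof.
move=> tF; elim: k => [|k IHk]; first exact: trig_closure_cst.
by apply: trig_closure_eq (trig_closureM tF IHk) _ => x; rewrite exprS.
Qed.

Lemma trig_closureB F G : trig_closure F -> trig_closure G ->
  trig_closure (fun x => F x - G x).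
Proof.
move=> tF tG; apply: trig_closure_eq (trig_closure_lin 1 (-1) tF tG) _ => x.
by rewrite mul1r mulN1r.
Qed.

Let indic_bool (p : pred (n.-tuple R)) x : \1_[set y | p y] x = (p x)%:R :> R.
Proof.
by rewrite indicE; congr (_%:R); congr nat_of_bool; apply/idP/idP; rewrite inE.
Qed.

Let expr01 (y : R) k : 0 <= y -> y <= 1 -> 0 <= y ^+ k <= 1.
Proof. by move=> y0 y1; rewrite exprn_ge0//= exprn_ile1. Qed.

(** As [k] grows, [1 - (1 - F ^ 2) ^ (k + 1)] tends to [1] where [F] is nonzero and is [0]
    elsewhere. *)
Lemma trig_closure_indic_neq0 F : trig_closure F -> (forall x, `|F x| <= 1) ->
  trig_closure \1_[set x | F x != 0].
Proof.
move=> tF F1.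
have F2 x : 0 <= 1 - F x ^+ 2 <= 1.
  rewrite subr_ge0 lerBlDr lerDl sqr_ge0 andbT.
  by rewrite -(@real_normK _ (F x))// ?num_real// exprn_ile1.
apply: (@trig_closure_lim (fun k x => 1 - (1 - F x ^+ 2) ^+ k.+1) _ 1).
- move=> k; apply: trig_closureB; first exact: trig_closure_cst.
  apply/trig_closureX/trig_closureB; first exact: trig_closure_cst.
  exact: trig_closureX.
- move=> k x; have /andP[h0 h1] := F2 x.
  have /andP[] := expr01 k.+1 h0 h1.
  by rewrite ler_norml => ? ?; apply/andP; split; lra.
- move=> x; rewrite indic_bool; have [Fx0|Fx0] := eqVneq (F x) 0.
    under eq_fun do rewrite Fx0 expr0n/= subr0 expr1n subrr.
    exact: cvg_cst.
  rewrite -[X in _ --> X]subr0.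
  apply: cvgB; first exact: cvg_cst.
  apply/cvgrPdist_lt => e e0.
  suff /cvgrPdist_lt/(_ e e0)[N _ NN] : (1 - F x ^+ 2) ^+ k @[k --> \oo] --> 0.
    by exists N => // k /= Nk; apply: NN => /=; exact: leqW.
  apply: cvg_expr; have /andP[h0 h1] := F2 x.
  rewrite ger0_norm// ltrBlDr ltrDl.
  by rewrite lt_neqAle sqr_ge0 eq_sym sqrf_eq0 Fx0.
Qed.

(* A polynomial in [y] tending to [1] on ]1/2, 1] and to [0] on [0, 1/2[; the
   point [1/2] is left out, whence the factor [\1_[set x | F x != 0]] in
   [trig_closure_indic_gt0]. *)
Let step (y : R) k := 1 - (1 - y ^+ k) ^+ (2 ^ k).

Let step01 y k : 0 <= y -> y <= 1 -> 0 <= step y k <= 1.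
Proof.
move=> y0 y1; have /andP[h0 h1] := expr01 k y0 y1.
have h2 : 0 <= 1 - y ^+ k by lra.
have h3 : 1 - y ^+ k <= 1 by lra.
have /andP[] := expr01 (2 ^ k) h2 h3.
by rewrite /step => ? ?; apply/andP; split; lra.
Qed.

Let bernoulli (u : R) k : -1 <= u -> 1 + k%:R * u <= (1 + u) ^+ k.
Proof.
move=> u1; elim: k => [|k IHk]; first by rewrite mul0r addr0 expr0.
rewrite exprS (@le_trans _ _ ((1 + u) * (1 + k%:R * u)))//; last first.
  by rewrite ler_wpM2l//; lra.
have k0 : 0 <= k%:R :> R by rewrite ler0n.
rewrite -[k.+1%:R]natr1.
have : 0 <= k%:R * u ^+ 2 by rewrite mulr_ge0// sqr_ge0.
rewrite expr2; lra.
Qed.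

(** Bernoulli with [u = - y ^ k] gives [step y k <= (2 * y) ^ k], a geometric sequence of ratio less
    than [1]. *)
Let cvg_step_lt y : 0 <= y -> y < 2^-1 -> step y k @[k --> \oo] --> (0 : R).
Proof.
move=> y0 y2; have y1 : y <= 1 by lra.
apply: (@squeeze_cvgr _ _ _ _ (cst 0) (fun k => (2 * y) ^+ k)) => /=.
- apply: nearW => k; have /andP[-> _]/= := step01 k y0 y1.
  have /andP[h0 h1] := expr01 k y0 y1.
  have := @bernoulli (- y ^+ k) (2 ^ k); rewrite natrX exprMn /step.
  have h : -1 <= - y ^+ k by lra.
  by move=> /(_ h); lra.
- exact: cvg_cst.
- by apply: cvg_expr; rewrite ger0_norm; lra.
Qed.

(** Here [(1 - y ^ k) ^ (2 ^ k) * (1 + y ^ k) ^ (2 ^ k) <= 1], and by Bernoulli the second factor is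
    at least [(2 * y) ^ k]; hence the first is at most [(2 * y) ^ (- k)]. *)
Let cvg_step_gt y : 2^-1 < y -> y <= 1 -> step y k @[k --> \oo] --> (1 : R).
Proof.
move=> y2 y1; have y0 : 0 <= y by lra.
apply: (@squeeze_cvgr _ _ _ _ (fun k => 1 - ((2 * y)^-1) ^+ k) (cst 1)) => /=.
- apply: nearW => k; have /andP[_ ->] := step01 k y0 y1; rewrite andbT.
  have /andP[h0 h1] := expr01 k y0 y1.
  rewrite /step lerD2l lerN2.
  have p0 : 0 < (2 * y) ^+ k by rewrite exprn_gt0//; lra.
  rewrite exprVn -[leRHS]mul1r ler_pdivlMr//.
  have h : -1 <= y ^+ k by lra.
  have := bernoulli (2 ^ k) h; rewrite natrX -exprMn => Hb.
  have q0 : 0 <= (1 - y ^+ k) ^+ (2 ^ k) by rewrite exprn_ge0//; lra.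
  apply: (@le_trans _ _ ((1 - y ^+ k) ^+ (2 ^ k) * (1 + y ^+ k) ^+ (2 ^ k))).
    by rewrite ler_wpM2l//; lra.
  rewrite -exprMn exprn_ile1//; first by rewrite mulr_ge0//; lra.
  have -> : (1 - y ^+ k) * (1 + y ^+ k) = 1 - (y ^+ k) ^+ 2 by rewrite expr2; ring.
  by rewrite lerBlDr lerDl sqr_ge0.
- rewrite -[X in _ --> X]subr0; apply: cvgB; first exact: cvg_cst.
  apply: cvg_expr; rewrite ger0_norm ?invr_ge0; last by lra.
  by rewrite invf_lt1; lra.
- exact: cvg_cst.
Qed.

Lemma trig_closure_indic_gt0 F : trig_closure F -> (forall x, `|F x| <= 1) ->
  trig_closure \1_[set x | 0 < F x].
Proof.
(* Affine map from [-1, 1] to [0, 1] that sends the sign change of [F] to the threshold [1/2] of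
   [step]. *)
move=> tF F1; pose y x := 2^-1 * F x + 2^-1 * 1.
have y01 x : 0 <= y x <= 1.
  by have := F1 x; rewrite ler_norml /y => /andP[? ?]; apply/andP; split; lra.
have ty : trig_closure y by apply: trig_closure_lin => //; exact: trig_closure_cst.
apply: (@trig_closure_lim
  (fun k x => step (y x) k * \1_[set x | F x != 0] x) _ 1).
- move=> k; apply: trig_closureM; last exact: trig_closure_indic_neq0.
  apply: trig_closureB; first exact: trig_closure_cst.
  apply/trig_closureX/trig_closureB; first exact: trig_closure_cst.
  exact: trig_closureX.
- move=> k x; have /andP[h0 h1] := y01 x.
  have /andP[s0 s1] := step01 k h0 h1.
  by rewrite normrM -[leRHS]mul1r ler_pM// ger0_norm// indicE; case: (_ \in _).
- move=> x; have /andP[h0 h1] := y01 x.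
  under eq_fun do rewrite indic_bool.
  rewrite indic_bool; have [Fx|Fx|_] := ltgtP (F x) 0.
  + under eq_fun do rewrite mulr1.
    by apply: cvg_step_lt => //; rewrite /y; lra.
  + under eq_fun do rewrite mulr1.
    by apply: cvg_step_gt => //; rewrite /y; lra.
  + under eq_fun do rewrite mulr0.
    exact: cvg_cst.
Qed.

Lemma trig_closure_indic_coord_gt (i : 'I_n) (a : R) :
  trig_closure \1_[set x | a < tnth x i].
Proof.
(* For [m > |x_i - a|] the argument of the sine is in ]-pi, pi[, so that the
   sine has the sign of [x_i - a]. *)
apply: (@trig_closure_lim
  (fun m => \1_[set x | 0 < sin (m.+1%:R^-1 * (tnth x i - a))]) _ 1).
- move=> m; apply: trig_closure_indic_gt0; last first.
    by move=> x; rewrite ler_norml sin_geN1 sin_le1.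
  (* The phase [- pi / 2] turns the cosine into a sine. *)
  apply: trig_closure_eq (trig_closure_cos
    (fun j => if j == i then m.+1%:R^-1 else 0) (- (m.+1%:R^-1 * a) - pi / 2)) _.
  move=> x; rewrite (bigD1 i)//= eqxx big1 ?addr0; last first.
    by move=> j /negbTE ->; rewrite mul0r.
  by rewrite addrA -mulrBr cosB cos_pihalf sin_pihalf mulr0 mulr1 add0r.
- by move=> k x; rewrite indicE; case: (_ \in _); rewrite ?normr0 ?normr1.
- move=> x; apply: cvg_near_cst.
  have := nbhs_infty_ger `|tnth x i - a|.
  apply: filterS => m mx; rewrite !indicE; congr (_%:R); congr nat_of_bool.
  have m0 : 0 < m.+1%:R :> R by rewrite ltr0n.
  have le1 : `|m.+1%:R^-1 * (tnth x i - a)| < pi.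
    rewrite normrM ger0_norm ?invr_ge0 ?ler0n// mulrC ltr_pdivrMr//.
    rewrite (le_lt_trans mx)//.
    have := pi_ge2 R => pi2.
    rewrite (@lt_le_trans _ _ m.+1%:R)//; first by rewrite ltr_nat.
    by rewrite ler_peMl// ?ler0n//; lra.
  apply/idP/idP; rewrite !inE/=.
  + apply: contraLR; rewrite -!leNgt => xa.
    have h : 0 <= - (m.+1%:R^-1 * (tnth x i - a)) <= pi.
      move: le1; rewrite ltr_norml => /andP[h _].
      rewrite oppr_ge0 mulr_ge0_le0 ?invr_ge0 ?ler0n ?subr_le0//=.
      by rewrite lerNl ltW.
    by have := sin_ge0_pi h; rewrite sinN oppr_ge0.
  + move=> xa; apply: sin_gt0_pi.
    move: le1; rewrite ltr_norml => /andP[_ ->]; rewrite andbT.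
    by rewrite mulr_gt0 ?invr_gt0 ?subr_gt0.
Qed.

(** Countable unions are reached through complements: indicators of finite intersections of
    complements are products, and [1] minus them converges to the indicator of the union. *)
Lemma trig_closure_sigma_algebra :
  sigma_algebra setT [set A | trig_closure \1_A].
Proof.
split => /= [|A tA|A tA].
- by rewrite indic0; exact: trig_closure_cst.
- rewrite setTD.
  apply: trig_closure_eq (trig_closureB (trig_closure_cst 1) tA) _ => x.
  by rewrite !indicE in_setC; case: (_ \in _); rewrite /= ?subrr ?subr0.
- have tB k : trig_closure \1_(\bigcap_(j < k) ~` A j).
    elim: k => [|k IHk].
      by rewrite bigcap_mkord big_ord0 indicT; exact: trig_closure_cst.
    rewrite bigcap_mkord big_ord_recr/= -(bigcap_mkord k (fun j => ~` A j)) indicI.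
    apply: trig_closureM => //.
    apply: trig_closure_eq (trig_closureB (trig_closure_cst 1) (tA k)) _ => x.
    by rewrite !indicE in_setC; case: (_ \in _); rewrite /= ?subrr ?subr0.
  apply: (@trig_closure_lim (fun k x => 1 - \1_(\bigcap_(j < k) ~` A j) x) _ 1).
  + by move=> k; apply: trig_closureB => //; exact: trig_closure_cst.
  + move=> k x; rewrite indicE; case: (_ \in _).
      by rewrite subrr normr0.
    by rewrite subr0 normr1.
  + move=> x; rewrite indicE; apply: cvg_near_cst.
    have [/set_mem[m _ Amx]|/negP nA] := boolP (x \in \bigcup_k A k).
      exists m.+1 => // k /= mk; rewrite indicE memNset ?subr0//.
      by move=> /(_ m mk).
    apply: nearW => k; rewrite indicE mem_set ?subrr// => j _ Ajx.
    by apply: nA; rewrite inE; exists j.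
Qed.

(** Two generation steps: coordinate preimages generate the product sigma-algebra, and open right
    rays generate the Borel sets of the line. *)
Lemma trig_closure_indic A : measurable A -> trig_closure \1_A.
Proof.
move: A; apply: smallest_sub; first exact: trig_closure_sigma_algebra.
rewrite -bigcup_seq => A [i _ [B mB]]; rewrite setTI => <-{A} /=.
have [tau0 tauC tauU] := trig_closure_sigma_algebra.
have := mB; rewrite -[measurable B]/((@ocitv R).-sigma.-measurable B).
rewrite RGenOInfty.measurableE => mGB.
suff: [set B | trig_closure \1_((fun x : n.-tuple R => tnth x i) @^-1` B)] B by [].
move: B mGB {mB}; apply: smallest_sub.
- split => /= [|B tB|B tB].
  + by rewrite preimage_set0; exact: tau0.
  + by rewrite setTD preimage_setC -setTD; exact: tauC.
  + by rewrite preimage_bigcup; exact: tauU.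
- move=> _ [a ->] /=.
  apply: trig_closure_eq (trig_closure_indic_coord_gt i a) _ => x.
  by rewrite !indicE/= preimage_itvoy.
Qed.

End trig_closure.

(** * Uniqueness of laws from characteristic functions *)

Section char_fun_uniqueness.
Context (R : realType) (n : nat).

Lemma trig_closure_measurable (F : n.-tuple R -> R) :
  trig_closure F -> measurable_fun setT F.
Proof.
elim=> {F} [theta phi|a b F G _ mF _ mG|F_ F K _ mF _ FF].
- apply: (measurableT_comp (continuous_measurable_fun (@continuous_cos R))).
  apply: measurable_funD => //; apply: measurable_sum => i.
  by apply: measurable_funM => //; exact: measurable_tnth.
- by apply: measurable_funD; exact: measurable_funM.
- by apply: (measurable_fun_cvg mF) => x _; exact: FF.
Qed.

Context d (T : measurableType d) (P : probability T R).

Lemma integrable_bounded (f : T -> R) (K : R) : measurable_fun setT f ->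
  (forall w, `|f w| <= K) -> P.-integrable setT (EFin \o f).
Proof.
move=> mf fK; apply: (@le_integrable _ _ _ P _ measurableT _ (EFin \o cst K)).
- exact/measurable_EFinP.
- by move=> w _ /=; rewrite lee_fin (le_trans (fK w))// ler_norm.
- exact: finite_measure_integrable_cst.
Qed.

Lemma Rintegral_bounded_cvg (f_ : nat -> T -> R) (f : T -> R) (K : R) :
  (forall k, measurable_fun setT (f_ k)) -> (forall k w, `|f_ k w| <= K) ->
  (forall w, f_ k w @[k --> \oo] --> f w) ->
  \int[P]_w f_ k w @[k --> \oo] --> \int[P]_w f w.
Proof.
move=> mf fK ff.
have mlim : measurable_fun setT f.
  by apply: (measurable_fun_cvg mf) => w _; exact: ff.
have [] := @dominated_convergence _ _ _ P setT measurableT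
  (fun k w => (f_ k w)%:E) (EFin \o f) (EFin \o cst K).
- by move=> k; exact/measurable_EFinP.
- exact/measurable_EFinP.
- by apply: nearW => w _; apply: cvg_EFin; [exact: nearW|exact: ff].
- exact: finite_measure_integrable_cst.
- by apply: nearW => w k _; rewrite lee_fin.
move=> /integrable_fin_num fi _ icvg.
by apply: fine_cvg; rewrite /Rintegral fineK// fi.
Qed.

Variables X Y : 'I_n -> T -> R.
Hypothesis mX : forall i, measurable_fun setT (X i).
Hypothesis mY : forall i, measurable_fun setT (Y i).

Let V (Z : 'I_n -> T -> R) w := [tuple Z i w | i < n].

Let mV Z : (forall i, measurable_fun setT (Z i)) -> measurable_fun setT (V Z).
Proof.
move=> mZ; apply/measurable_fun_tnthP => i.
have -> // : (@tnth n R)^~ i \o V Z = Z i.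
by apply/funext => w /=; rewrite tnth_mktuple.
Qed.

Let Rintegral_lin (a b : R) (F G : n.-tuple R -> R) Z :
  (forall i, measurable_fun setT (Z i)) -> trig_closure F -> trig_closure G ->
  \int[P]_w (a * F (V Z w) + b * G (V Z w)) =
  a * \int[P]_w F (V Z w) + b * \int[P]_w G (V Z w).
Proof.
move=> mZ tF tG.
have iF H : trig_closure H -> P.-integrable setT (EFin \o (H \o V Z)).
  move=> tH; have [K HK] := trig_closure_bounded tH.
  apply: (@integrable_bounded _ K) => [|w]; last exact: HK.
  by apply: measurableT_comp; [exact: trig_closure_measurable|exact: mV].
rewrite RintegralD//.
- by rewrite !RintegralZl//; [exact: (iF G)|exact: (iF F)].
- by apply: (integrableZl measurableT a (iF F tF)).
- by apply: (integrableZl measurableT b (iF G tG)).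
Qed.

(** Induction on the closure: cosines by hypothesis, combinations by linearity, limits by dominated
    convergence with a constant bound. *)
Let Rintegral_trig_closure F :
  (forall theta phi, \int[P]_w cos (\sum_i theta i * X i w + phi) =
                     \int[P]_w cos (\sum_i theta i * Y i w + phi)) ->
  trig_closure F -> \int[P]_w F (V X w) = \int[P]_w F (V Y w).
Proof.
move=> XY; elim=> {F} [theta phi|a b F G tF IF tG IG|F_ F K tF IF FK FF].
- under eq_Rintegral do under eq_bigr do rewrite tnth_mktuple.
  by under [RHS]eq_Rintegral do under eq_bigr do rewrite tnth_mktuple.
- by rewrite !Rintegral_lin// IF IG.
- have h Z : (forall i, measurable_fun setT (Z i)) ->
      \int[P]_w F_ k (V Z w) @[k --> \oo] --> \int[P]_w F (V Z w).
    move=> mZ; apply: (@Rintegral_bounded_cvg _ _ K) => [k|k w|w]; first last.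
      exact: FF.
      exact: FK.
    by apply: measurableT_comp; [exact: trig_closure_measurable|exact: mV].
  have hX := h _ mX; have hY := h _ mY.
  rewrite -(cvg_lim (@norm_hausdorff _ R) hX) -(cvg_lim (@norm_hausdorff _ R) hY).
  by congr (limn _); apply/funext => k; exact: IF.
Qed.

(** Comparing values at [1] suffices, since any frequency can be absorbed in [theta]. The
    expectations of all members of the closure then agree, in particular those of indicators. *)
Lemma Cramer_Wold :
  (forall theta : 'I_n -> R,
    char_fun P (fun w => \sum_i theta i * X i w) 1 =
    char_fun P (fun w => \sum_i theta i * Y i w) 1) ->
  forall B, measurable B -> pushforward P (V X) B = pushforward P (V Y) B.
Proof.
move=> XY B mB.
have mS (Z : 'I_n -> T -> R) (theta : 'I_n -> R) :
    (forall i, measurable_fun setT (Z i)) ->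
    measurable_fun setT (fun w => \sum_i theta i * Z i w).
  by move=> mZ; apply: measurable_sum => i; exact: measurable_funM.
(* The addition formula recovers every phase [phi] from the real and imaginary parts. *)
have cosE (Z : 'I_n -> T -> R) (theta : 'I_n -> R) phi :
    (forall i, measurable_fun setT (Z i)) ->
    \int[P]_w cos (\sum_i theta i * Z i w + phi) =
    cos phi * complex.Re (char_fun P (fun w => \sum_i theta i * Z i w) 1) -
    sin phi * complex.Im (char_fun P (fun w => \sum_i theta i * Z i w) 1).
  move=> mZ /=.
  have ic : P.-integrable setT
      (EFin \o (fun w => cos (1 * \sum_i theta i * Z i w))).
    apply: (@integrable_bounded _ 1) => [|w].
      apply: (measurableT_comp (continuous_measurable_fun (@continuous_cos R))).
      by apply: measurable_funM => //; exact: mS.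
    by rewrite ler_norml cos_geN1 cos_le1.
  have isn : P.-integrable setT
      (EFin \o (fun w => sin (1 * \sum_i theta i * Z i w))).
    apply: (@integrable_bounded _ 1) => [|w].
      apply: (measurableT_comp (continuous_measurable_fun (@continuous_sin R))).
      by apply: measurable_funM => //; exact: mS.
    by rewrite ler_norml sin_geN1 sin_le1.
  rewrite -!RintegralZl// -RintegralB//.
  - by apply: eq_Rintegral => w _; rewrite cosD mul1r mulrC [_ * sin phi]mulrC.
  - exact: (integrableZl measurableT _ ic).
  - exact: (integrableZl measurableT _ isn).
have PE (Z : 'I_n -> T -> R) : (forall i, measurable_fun setT (Z i)) ->
    pushforward P (V Z) B = (\int[P]_w \1_B (V Z w))%:E.
  move=> mZ; rewrite /Rintegral.
  have mVB : measurable (V Z @^-1` B).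
    by rewrite -[_ @^-1` _]setTI; exact: mV.
  rewrite -[X in (fine X)%:E]/(\int[P]_w (\1_(V Z @^-1` B) w)%:E)%E.
  by rewrite integral_indic// setIT fineK// fin_num_measure.
rewrite !PE//; congr (_%:E); apply: Rintegral_trig_closure.
  by move=> theta phi; rewrite !cosE// XY.
exact: trig_closure_indic.
Qed.

End char_fun_uniqueness.

(** * Homogeneity of the control measure *)

Section scaling.
Context (R : realType).
Implicit Types (l beta : R).
Local Open Scope ereal_scope.

(** The hypothesis on preimages says that the image of [m] under [phi] is [c * m], so this is a
    change of variables. *)
Lemma ge0_integral_comp_scaled d (T : measurableType d)
    (m : {measure set T -> \bar R}) (phi : T -> T) (c : R)
    (f : T -> \bar R) :
  measurable_fun setT phi -> (0 <= c)%R ->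
  (forall A, measurable A -> m (phi @^-1` A) = c%:E * m A) ->
  measurable_fun setT f -> (forall x, 0 <= f x) ->
  \int[m]_x f (phi x) = c%:E * \int[m]_x f x.
Proof.
move=> mphi c0 mE mf f0.
rewrite -[c]/((NngNum c0)%:num)%R -ge0_integral_mscale//.
rewrite -[LHS]/(\int[m]_(x in phi @^-1` setT) (f \o phi) x).
rewrite -ge0_integral_pushforward//.
by apply: eq_measure_integral => A mA _; exact: mE.
Qed.

Lemma measurable_scale l : measurable_fun [set: R] ( *%R l).
Proof. exact: (@measurable_funM _ _ R setT (cst l) id). Qed.

(** By uniqueness of Lebesgue measure: [l] times its image under multiplication by [l] gives
    half-open intervals their length. *)
Lemma lebesgue_measureZ l (A : set R) : (0 < l)%R -> measurable A ->
  lebesgue_measure (( *%R l) @^-1` A) = l^-1%:E * lebesgue_measure A.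
Proof.
move=> l0 mA.
have ml : measurable_fun setT ( *%R l : measurableTypeR R -> measurableTypeR R).
  exact: measurable_scale.
pose mu : {measure set (measurableTypeR R) -> \bar R} :=
  mscale (NngNum (ltW l0)) (pushforward lebesgue_measure
    ( *%R l : measurableTypeR R -> measurableTypeR R)).
suff muE : lebesgue_measure A = mu ml A.
  by rewrite muE /mu/= /mscale/= muleA -EFinM mulVf ?gt_eqF// mul1e.
apply: lebesgue_measure_unique => // _ [[a b]] _ <-.
rewrite /mu/= /mscale/= /pushforward.
have -> : ( *%R l) @^-1` [set` `]a, b]] = [set` `](l^-1 * a)%R, (l^-1 * b)%R]].
  apply/seteqP; split => x /=; rewrite !in_itv/= ltr_pdivrMl// ler_pdivlMl//.
rewrite !lebesgue_measure_itv/= !lte_fin ltr_pM2l ?invr_gt0//.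
case: ifPn => _; last by rewrite mule0.
by rewrite -!EFinB -EFinM -mulrBr mulrA divff ?gt_eqF// mul1r.
Qed.

(** The density at [r] is [l ^ (beta + 1)] times that at [l * r], and [dr] contributes
    [l ^ (- 1)]. *)
Lemma radial_measureZ beta (beta_gt0 : (0 < beta)%R) l (A : set R) :
  (0 < l)%R -> measurable A ->
  radial_measure beta_gt0 (( *%R l) @^-1` A) =
  (l `^ beta)%:E * radial_measure beta_gt0 A.
Proof.
move=> l0 mA; rewrite /radial_measure !(integral_mkcond (_ `&` _)).
set g := (fun r => (beta * r `^ (- beta - 1))%:E) \_ (A `&` `]0%R, +oo[).
have mg : measurable_fun setT g.
  apply/(measurable_restrictT _ _).1.
    by apply: measurableI => //; exact: measurable_itv.
  by apply/measurable_EFinP/measurable_funTS; exact: measurable_funM.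
have g0 r : 0 <= g r.
  rewrite /g patchE; case: ifPn => // _.
  by rewrite lee_fin mulr_ge0 ?powR_ge0// ltW.
transitivity (\int[lebesgue_measure]_r ((l `^ (beta + 1))%:E * g (l * r)%R)).
  apply: eq_integral => r _; rewrite /g !patchE.
  have -> : (r \in ( *%R l @^-1` A) `&` `]0%R, +oo[) =
      ((l * r)%R \in A `&` `]0%R, +oo[).
    by apply/idP/idP; rewrite !inE/= !in_itv/= !andbT pmulr_rgt0.
  case: ifPn => [|_]; last by rewrite mule0.
  rewrite inE/= in_itv/= andbT pmulr_rgt0// => -[_ r0].
  rewrite -EFinM powRM ?ltW// mulrCA; congr (_%:E); congr (_ * _)%R.
  rewrite mulrA -powRD; last by rewrite (gt_eqF l0) implybT.
  by rewrite -opprD subrr powRr0 mul1r.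
have mgl : measurable_fun setT (fun r : R => g (l * r)%R).
  by apply: measurableT_comp => //; exact: measurable_scale.
have -> := @ge0_integralZl _ _ _ lebesgue_measure setT measurableT _ mgl
  (l `^ (beta + 1))%:E (fun r _ => g0 (l * r)%R) (powR_ge0 _ _).
rewrite (@ge0_integral_comp_scaled _ _ lebesgue_measure ( *%R l) l^-1)//; first last.
- by move=> B mB; exact: lebesgue_measureZ.
- by rewrite invr_ge0 ltW.
rewrite muleA -EFinM powRD; last by rewrite (gt_eqF l0) implybT.
by rewrite powRr1 ?ltW// -mulrA divff ?gt_eqF// mulr1.
Qed.

Let phi d (T : measurableType d) l (x : R * T) := (l * x.1, x.2)%R.

Let measurable_phi d (T : measurableType d) l : measurable_fun setT (@phi _ T l).
Proof.
apply: measurable_fun_pair => //.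
by apply: measurableT_comp; first exact: measurable_scale.
Qed.

Variables (d : measure_display) (T : measurableType d) (P : probability T R).
Variables (beta : R) (beta_gt0 : (0 < beta)%R).

(** The dilation acts on the radial variable only: the section of the preimage at [r] is the section
    of [A] at [l * r]. *)
Lemma control_measureZ l (A : set (R * T)) : (0 < l)%R -> measurable A ->
  control_measure P beta_gt0 ((fun x => (l * x.1, x.2)%R) @^-1` A) =
  (l `^ beta)%:E * control_measure P beta_gt0 A.
Proof.
move=> l0 mA; rewrite /control_measure /= /product_measure1.
apply: (@ge0_integral_comp_scaled _ _ (radial_measure beta_gt0) ( *%R l) _
    (P \o xsection A)).
- exact: measurable_scale.
- exact: powR_ge0.
- by move=> B mB; exact: radial_measureZ.
- exact: measurable_fun_xsection.
- by move=> x; exact: measure_ge0.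
Qed.

Lemma ge0_integral_controlZ l (f : R * T -> \bar R) :
  (0 < l)%R -> measurable_fun setT f -> (forall x, 0 <= f x) ->
  \int[control_measure P beta_gt0]_x f (l * x.1, x.2)%R =
  (l `^ beta)%:E * \int[control_measure P beta_gt0]_x f x.
Proof.
move=> l0 mf f0; apply: (@ge0_integral_comp_scaled _ _ _ (@phi _ T l)) => //.
- exact: measurable_phi.
- exact: powR_ge0.
- by move=> A mA; exact: control_measureZ.
Qed.

End scaling.

(** * Measurability and finite mass of the odd occupancy sets *)

Lemma measure_lty_geometric d (T : measurableType d) (R : realType)
    (m : {measure set T -> \bar R}) (A : set T) (F : nat -> set T) (C q : R) :
  measurable A -> (forall k, measurable (F k)) -> A `<=` \bigcup_k F k ->
  0 <= C -> 0 <= q -> q < 1 ->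
  (forall k, m (F k) <= (C * q ^+ k)%:E)%E -> (m A < +oo)%E.
Proof.
move=> mA mF AF C0 q0 q1 mFq.
(* Every partial sum of the dominating geometric series is at most [C / (1 - q)]. *)
apply: (le_lt_trans (measure_sigma_subadditive m mF mA AF)).
apply: (@le_lt_trans _ _ (C / (1 - q))%:E); last exact: ltry.
apply: lime_le.
  by apply: is_cvg_nneseries => k _ _; exact: measure_ge0.
apply: nearW => n.
apply: (@le_trans _ _ (\sum_(0 <= k < n) (C * q ^+ k)%:E)%E).
  by apply: lee_sum => k _; exact: mFq.
rewrite sumEFin lee_fin.
have q1' : 0 < 1 - q by rewrite subr_gt0.
rewrite ler_pdivlMr//.
have -> : (\sum_(0 <= k < n) C * q ^+ k) * (1 - q) = C * (1 - q ^+ n).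
  elim: n => [|n IHn]; first by rewrite big_geq// mul0r expr0 subrr mulr0.
  by rewrite big_nat_recr//= mulrDl IHn exprS; ring.
by rewrite ler_piMr// lerBlDr lerDl exprn_ge0.
Qed.

Section odd_occupancy.
Context (R : realType) d (T : measurableType d) (P : probability T R).
Variables (N : R -> {RV P >-> nat}) (N_Poisson : standard_Poisson_process N).

Lemma odd_occupancyM (l t : R) : 0 < l ->
  odd_occupancy N (l * t) =
  (fun x => (l * x.1, x.2)) @^-1` odd_occupancy N t.
Proof.
move=> l0; apply/seteqP; split => -[r w];
  by rewrite /odd_occupancy/= pmulr_rge0// -mulrA mulrCA.
Qed.

Lemma odd_occupancy0 : odd_occupancy N 0 = set0.
Proof.
apply/seteqP; split => // -[r w] /= [_].
by rewrite mul0r (Poisson_start N_Poisson).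
Qed.

Lemma measurable_odd_Poisson (t : R) : measurable [set w | odd (N t w)].
Proof.
have := @measurable_funPT _ _ _ _ (N t) measurableT [set n | odd n].
by rewrite setTI; exact.
Qed.

(** Singletons of [nat] are open, so right continuity means being constant just after [t]. *)
Lemma Poisson_right_cst (t : R) w : 0 <= t ->
  exists2 e : R, 0 < e & forall s, t < s -> s < t + e -> N s w = N t w.
Proof.
move=> t0; have /(_ [set N t w]) :=
  @Poisson_right_continuous _ _ _ _ _ N_Poisson t w t0.
have h : nbhs (N t w) [set N t w].
  by rewrite nbhs_principalE; exact/principal_filterP.
move=> /(_ h) [e/= e0 He]; exists e => // s ts ste.
apply: He => //=; rewrite ltr0_norm ?subr_lt0// opprB ltrBlDr addrC//.
Qed.

(* A grid point strictly to the right of [r], as required to exploit right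
   continuity. *)
Let approx (m : nat) (r : R) : R := (Num.truncn (r * m.+1%:R)).+1%:R / m.+1%:R.

Let approx_gt m r : 0 <= r -> r < approx m r.
Proof.
by move=> r0; rewrite /approx ltr_pdivlMr ?ltr0n// truncnS_gt.
Qed.

Let approx_le m r : 0 <= r -> approx m r <= r + m.+1%:R^-1.
Proof.
move=> r0; rewrite /approx ler_pdivrMr ?ltr0n// mulrDl mulVf ?pnatr_eq0//.
by rewrite -natr1 lerD2r truncn_le mulr_ge0.
Qed.

Let odd_approx m := [set x : R * T | 0 <= x.1 /\ odd (N (approx m x.1) x.2)].

(** On each radial cell of length [1 / (m + 1)] the grid point is constant, so the set is a
    countable union of rectangles. *)
Let measurable_odd_approx m : measurable (odd_approx m).
Proof.
have -> : odd_approx m = \bigcup_j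
    (`[j%:R / m.+1%:R, j.+1%:R / m.+1%:R[%classic `*`
     [set w | odd (N (j.+1%:R / m.+1%:R) w)]).
  apply/seteqP; split => -[r w] /=.
    move=> [r0 Nrw]; exists (Num.truncn (r * m.+1%:R)) => //; split => //=.
    rewrite in_itv/= ler_pdivrMr ?ltr0n// ltr_pdivlMr ?ltr0n//.
    by apply: truncn_itv; rewrite mulr_ge0.
  move=> [j _ [/=]].
  rewrite in_itv/= ler_pdivrMr ?ltr0n// ltr_pdivlMr ?ltr0n// => rj Njw.
  split; last by rewrite /approx (truncn_def rj).
  have /andP[+ _] := rj.
  by move=> /(le_trans (ler0n _ _)); rewrite pmulr_lge0.
apply: bigcup_measurable => j _; apply: measurableX.
  exact: measurable_itv.
exact: measurable_odd_Poisson.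
Qed.

(** The grid points approach [r] from the right, so by local constancy [N] takes there its value at
    [r] for all large [m]: the set is the limit inferior of the discretised ones. *)
Let measurable_odd_occupancy1 : measurable (odd_occupancy N 1).
Proof.
have -> : odd_occupancy N 1 = \bigcup_k \bigcap_(m >= k) odd_approx m.
  have near_eq r w : 0 <= r -> exists k,
      forall m, (k <= m)%N -> N (approx m r) w = N r w.
    move=> r0; have [e e0 He] := Poisson_right_cst w r0.
    exists (Num.truncn e^-1) => m km; apply: He; first exact: approx_gt.
    rewrite (le_lt_trans (approx_le m r0))// ltrD2l.
    rewrite invf_plt ?posrE ?ltr0n//.
    by rewrite (lt_le_trans (truncnS_gt _))// ler_nat.
  apply/seteqP; split => -[r w] /=.
    move=> [r0]; rewrite mul1r => Nrw; have [k Hk] := near_eq r w r0.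
    by exists k => // m /= km; split => //=; rewrite Hk.
  move=> [k _ Hk]; have [r0 _] := Hk k (leqnn k); split => //.
  have [k' Hk'] := near_eq r w r0; rewrite mul1r -(Hk' (maxn k k')) ?leq_maxr//.
  by have [] := Hk (maxn k k') (leq_maxl _ _).
apply: bigcup_measurable => k _; apply: bigcap_measurable => //.
by exists k => /=.
Qed.

Lemma measurable_odd_occupancy (t : R) : 0 <= t ->
  measurable (odd_occupancy N t).
Proof.
rewrite le_eqVlt => /predU1P[<-|t0]; first by rewrite odd_occupancy0.
rewrite -[t]mulr1 odd_occupancyM// -[_ @^-1` _]setTI.
apply: measurable_fun_pair => //.
by apply: measurableT_comp; first exact: measurable_scale.
Qed.

(** An odd count is nonzero, and [1 - exp (- r) <= r]. *)
Lemma odd_Poisson_le (r : R) : 0 < r -> (P [set w | odd (N r w)] <= r%:E)%E.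
Proof.
move=> r0.
have m0 : measurable [set w | (N r w - N 0 w)%N = 0%N].
  have := @measurable_funPT _ _ _ _ (N r) measurableT [set 0%N].
  rewrite setTI => /(_ I); congr measurable; apply/seteqP.
  by split => w /=; rewrite (Poisson_start N_Poisson) subn0.
have sub : [set w | odd (N r w)] `<=` ~` [set w | (N r w - N 0 w)%N = 0%N].
  move=> w /= + h; move: h; rewrite (Poisson_start N_Poisson) subn0 => ->//.
apply: (@le_trans _ _ (P (~` [set w | (N r w - N 0 w)%N = 0%N]))).
  apply: le_measure => //; rewrite inE; first exact: measurable_odd_Poisson.
  exact: measurableC.
rewrite (probability_setC P m0) (Poisson_increments N_Poisson)// subr0.
rewrite /poisson_pmf r0 expr0 fact0 invr1 !mul1r -EFinB lee_fin.
by rewrite lerBlDr -lerBlDl expR_ge1Dx.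
Qed.

Variables (beta : R) (beta_gt0 : 0 < beta) (beta_lt1 : beta < 1).
Local Notation radial := (radial_measure beta_gt0).

(** The density is decreasing, hence bounded by its value at [1/2]. *)
Let radial_half_lty : (radial `[2^-1%R, 1%R[ < +oo)%E.
Proof.
pose C : R := beta * (2^-1)`^(- beta - 1).
apply: (@le_lt_trans _ _
  (\int[lebesgue_measure]_(x in `[2^-1%R, 1%R[) (cst C%:E x))%E); last first.
  rewrite integral_cst//= lebesgue_measure_itv/= lte_fin ifT; last by lra.
  by rewrite -EFinB -EFinM ltry.
rewrite /radial_measure (_ : _ `&` _ = `[2^-1, 1[%classic); last first.
  apply/seteqP; split => x /=; first by case.
  rewrite !in_itv/= andbT => /andP[h ->]; rewrite h; split => //.
  by rewrite (lt_le_trans _ h)// invr_gt0.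
apply: ge0_le_integral => //.
- by move=> x _; rewrite lee_fin mulr_ge0 ?powR_ge0// ltW.
- by apply/measurable_EFinP/measurable_funTS; exact: measurable_funM.
- move=> x /=; rewrite in_itv/= => /andP[x2 _].
  rewrite lee_fin /C ler_wpM2l ?(ltW beta_gt0)// -opprD !powRN.
  rewrite lef_pV2 ?posrE ?powR_gt0//.
    apply: ge0_ler_powR => //; rewrite ?nnegrE ?invr_ge0//.
      by rewrite addr_ge0 ?ltW.
    by rewrite (le_trans _ x2).
  by rewrite (lt_le_trans _ x2).
Qed.

(** The interval is the preimage of [1/2, 1[ under division by [l], to which homogeneity applies. *)
Let radial_dyadic (l : R) : 0 < l ->
  radial `[(l / 2)%R, l[ = ((l^-1) `^ beta * fine (radial `[2^-1%R, 1%R[))%:E.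
Proof.
move=> l0; rewrite EFinM fineK; last first.
  by rewrite ge0_fin_numE ?measure_ge0//; exact: radial_half_lty.
rewrite -radial_measureZ ?invr_gt0//.
congr radial_measure; apply/seteqP; split => x /=;
  by rewrite !in_itv/= -ler_pdivrMl ?invr_gt0// invrK ltr_pdivrMl// mulr1.
Qed.

(** Integration of the sections over [r]: they are empty off [a, b[ and have probability at most [c]
    on it. *)
Let control_strip (a b c : R) : 0 <= c ->
  (forall r, a <= r < b -> (P [set w | odd (N r w)] <= c%:E)%E) ->
  0 <= a ->
  (control_measure P beta_gt0 (odd_occupancy N 1 `&` (`[a, b[%classic `*` setT)) <=
   c%:E * radial `[a, b[)%E.
Proof.
move=> c0 Pc a0.
have mS : measurable (odd_occupancy N 1 `&` (`[a, b[%classic `*` setT)).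
  by apply: measurableI => //; apply: measurableX.
rewrite /control_measure/= /product_measure1.
rewrite -[leRHS]integral_cst//.
rewrite [leRHS]integral_mkcond; apply: ge0_le_integral => //.
- exact: measurable_fun_xsection.
- by apply/(measurable_restrictT _ _).1 => //; exact: measurable_itv.
- move=> r _ /=; rewrite patchE; case: ifPn => rab.
    apply: le_trans (Pc r _); last by move: rab; rewrite inE/= in_itv.
    apply: le_measure; rewrite ?inE.
    + exact: measurable_xsection.
    + exact: measurable_odd_Poisson.
    + move=> w; rewrite /xsection/= inE/= => -[[_]].
      by rewrite mul1r.
  rewrite (_ : xsection _ _ = set0) ?measure0//.
  apply/seteqP; split => // w; rewrite /xsection/= inE/= => -[_ [rab' _]].
  by move: rab; rewrite notin_setE.
Qed.

Let powRX (x : R) (k : nat) : 0 <= x -> (x ^+ k) `^ beta = (x `^ beta) ^+ k.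
Proof. by move=> x0; rewrite -!powR_mulrn ?powR_ge0// -!powRrM mulrC. Qed.

Let C := fine (radial `[2^-1%R, 1%R[).

Let C0 : 0 <= C.
Proof. by apply: fine_ge0; exact: measure_ge0. Qed.

(** This bound makes the ratio [2 ^ (- beta)] at infinity less than [1]; the next one, which uses
    [beta < 1], does so for the ratio [2 ^ (beta - 1)] at the origin. *)
Let powR2_gt1 : 1 < 2 `^ beta :> R.
Proof. by rewrite /powR gt_eqF// expR_gt1 mulr_gt0// ln_gt0// ltr1n. Qed.

Let powR2_lt2 : 2 `^ beta < 2 :> R.
Proof.
rewrite /powR gt_eqF// -[ltRHS]lnK ?posrE// ltr_expR.
by rewrite gtr_pMl// ln_gt0// ltr1n.
Qed.

Let strip (l : R) :=
  odd_occupancy N 1 `&` (`[(l / 2)%R, l[%classic `*` [set: T]).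

Let measurable_strip l : measurable (strip l).
Proof. by apply: measurableI => //; apply: measurableX. Qed.

Let measurable_lt1 : measurable [set r : R | r < 1].
Proof.
have -> : [set r : R | r < 1] = `]-oo, 1[%classic by rewrite set_itvE.
exact: measurable_itv.
Qed.

Let measurable_ge1 : measurable [set r : R | 1 <= r].
Proof.
have -> : [set r : R | 1 <= r] = `[1, +oo[%classic by rewrite set_itvE.
exact: measurable_itv.
Qed.

Let near0_lty : (control_measure P beta_gt0
  (odd_occupancy N 1 `&` ([set r | r < 1]%R `*` setT)) < +oo)%E.
Proof.
have l0 k : 0 < 2^-1 ^+ k :> R by rewrite exprn_gt0// invr_gt0.
(* On the [k]-th strip the parity event has probability at most [2 ^ (- k)], against a radial mass
   [C * 2 ^ (beta * k)]. *)
apply: (@measure_lty_geometric _ _ _ _ _ (fun k => strip (2^-1 ^+ k)) C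
  (2 `^ beta / 2)) => //.
- apply: measurableI => //; apply: measurableX => //.
- move=> [r w] [[/= r0 Nr] [/= r1 _]].
  (* The radius [0] is excluded because [N 0 = 0] is even. *)
  have {}r0 : 0 < r.
    rewrite lt_neqAle r0 andbT; apply: contraPneq Nr => <-.
    by rewrite mulr0 (Poisson_start N_Poisson).
  have ex : exists k, 2^-1 ^+ k.+1 <= r.
    have h : `|2^-1| < 1 :> R by rewrite ger0_norm ?invr_ge0// invf_lt1// ltr1n.
    have /cvgrPdist_le/(_ _ r0)[m _ /(_ m.+1 (leqnSn m))] := cvg_expr h.
    by rewrite /= sub0r normrN ger0_norm ?exprn_ge0 ?invr_ge0// => ?; exists m.
  (* Minimality of [k] gives [r < 2 ^ (- k)]; for [k = 0] this is the assumption [r < 1]. *)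
  case: (ex_minnP ex) => k kr kmin; exists k => //.
  split; [by split => //=; exact: ltW|split => //=].
  rewrite in_itv/= -exprSr kr/= ltNge; apply/negP => rk.
  case: k => [|k] in kr kmin rk *; first by rewrite expr0 leNgt r1 in rk.
  by have := kmin _ rk; rewrite ltnn.
- by rewrite ltr_pdivrMr// mul1r.
- move=> k; apply: (le_trans (control_strip (c := 2^-1 ^+ k) _ _ _)).
  + exact: ltW.
  + move=> r /andP[rk kr]; apply: (le_trans (odd_Poisson_le _)).
      by rewrite (lt_le_trans _ rk)// divr_gt0.
    by rewrite lee_fin ltW.
  + by rewrite divr_ge0// ltW.
  rewrite radial_dyadic// -EFinM lee_fin exprVn invrK powRX// -/C.
  by rewrite expr_div_n mulrCA mulrA mulrC mulrA.
Qed.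

Let near1_lty : (control_measure P beta_gt0
  (odd_occupancy N 1 `&` ([set r | 1 <= r]%R `*` setT)) < +oo)%E.
Proof.
have l0 k : 0 < 2 ^+ k :> R by rewrite exprn_gt0.
(* The shift to [k + 1] makes the first strip start at [1]. Probabilities are bounded by [1], and
   the radial mass is [C * 2 ^ (- beta * (k + 1))]. *)
apply: (@measure_lty_geometric _ _ _ _ _ (fun k => strip (2 ^+ k.+1))
  (C / 2 `^ beta) (2 `^ beta)^-1) => //.
- apply: measurableI => //; apply: measurableX => //.
- move=> [r w] [Nr [/= r1 _]].
  have ex : exists k, r < 2 ^+ k.+1.
    exists (Num.truncn r); rewrite (lt_trans (truncnS_gt _))//.
    by rewrite -natrX ltr_nat ltn_expl.
  case: (ex_minnP ex) => k kr kmin; exists k => //; split => //=; split => //.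
  rewrite in_itv/= kr exprSr mulfK ?pnatr_eq0// andbT leNgt; apply/negP => rk.
  case: k => [|k] in kr kmin rk *; first by rewrite expr0 ltNge r1 in rk.
  by have := kmin _ rk; rewrite ltnn.
- by rewrite divr_ge0// powR_ge0.
- by rewrite invf_lt1// (lt_trans _ powR2_gt1).
- move=> k; apply: (le_trans (control_strip (c := 1) _ _ _)) => //.
  + by move=> r _; apply: probability_le1; exact: measurable_odd_Poisson.
  rewrite radial_dyadic// mul1e lee_fin -exprVn powRX ?invr_ge0// -/C.
  have -> : 2^-1 `^ beta = (2 `^ beta)^-1 :> R.
    by rewrite -powR_inv1// -powRrM mulN1r powRN.
  by rewrite exprS mulrC mulrA.
Qed.

(** Homogeneity reduces [t > 0] to [t = 1], where the set is cut at radius [1]. *)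
Lemma control_measure_odd_occupancy_lty (t : R) : 0 <= t ->
  (control_measure P beta_gt0 (odd_occupancy N t) < +oo)%E.
Proof.
rewrite le_eqVlt => /predU1P[<-|t0]; first by rewrite odd_occupancy0 measure0.
rewrite -[t]mulr1 odd_occupancyM// control_measureZ//.
apply: lte_mul_pinfty => //; first by rewrite lee_fin powR_ge0.
set near0 := odd_occupancy N 1 `&` ([set r | r < 1] `*` setT).
set near1 := odd_occupancy N 1 `&` ([set r | 1 <= r] `*` setT).
have m0 : measurable near0.
  apply: measurableI => //; apply: measurableX => //.
have m1 : measurable near1.
  apply: measurableI => //; apply: measurableX => //.
rewrite (_ : odd_occupancy N 1 = near0 `|` near1); last first.
  apply/seteqP; split => [[r w] Nr|[r w] [] []//].
  by have [r1|r1] := ltP r 1; [left|right].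
apply: (le_lt_trans (measureU2 _ m0 m1)).
by rewrite lte_add_pinfty.
Qed.

End odd_occupancy.

(** * Stable integrals of linear combinations *)

Section integral_of_linear_combinations.
Context d (E : measurableType d) (R : realType).
Context (m : {measure set E -> \bar R}).

(* A subspace of every [L^alpha], including [alpha < 1] where the library does
   not provide the vector space structure of [Lfun]. *)
Definition bounded_finite_support (f : E -> R) : Prop :=
  measurable_fun setT f /\ exists A K,
    [/\ measurable A, (m A < +oo)%E & forall x, `|f x| <= K * \1_A x].

Lemma bounded_finite_support_indic A : measurable A -> (m A < +oo)%E ->
  bounded_finite_support \1_A.
Proof.
move=> mA fA; split; first exact: measurable_indic.
by exists A, 1; split => // x; rewrite mul1r ger0_norm// indicE ler0n.
Qed.

Lemma bounded_finite_support0 : bounded_finite_support (cst 0).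
Proof.
split => //; exists set0, 0; split; rewrite ?measure0// => x.
by rewrite normr0 mul0r.
Qed.

Lemma bounded_finite_support_lin (a b : R) f g :
  bounded_finite_support f -> bounded_finite_support g ->
  bounded_finite_support (fun x => a * f x + b * g x).
Proof.
move=> [mf [A [K [mA fA fK]]]] [mg [B [L [mB fB gL]]]]; split.
  by apply: measurable_funD; apply: measurable_funM.
(* The constants [K] and [L] are not assumed nonnegative; their absolute values allow the supports
   to be enlarged. *)
exists (A `|` B), (`|a| * `|K| + `|b| * `|L|); split.
- exact: measurableU.
- by apply: (le_lt_trans (measureU2 _ mA mB)); rewrite lte_add_pinfty.
- move=> x; rewrite (le_trans (ler_normD _ _))// mulrDl !normrM -!mulrA.
  have h (k : R) (S : set E) : S `<=` A `|` B ->
      k * \1_S x <= `|k| * \1_(A `|` B) x.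
    move=> SAB; apply: (@le_trans _ _ (`|k| * \1_S x)).
      by rewrite ler_wpM2r ?ler_norm// indicE ler0n.
    rewrite ler_wpM2l// !indicE ler_nat.
    by case: (boolP (x \in S)) => // /set_mem/SAB/mem_set ->.
  rewrite lerD// ler_wpM2l//.
    by rewrite (le_trans (fK x))// h// => ?; left.
  by rewrite (le_trans (gL x))// h// => ?; right.
Qed.

Lemma bounded_finite_support_sum n (theta : 'I_n -> R) (f : 'I_n -> E -> R) :
  (forall i, bounded_finite_support (f i)) ->
  bounded_finite_support (fun x => \sum_i theta i * f i x).
Proof.
elim: n theta f => [|n IHn] theta f bf.
  rewrite (_ : (fun _ => _) = cst 0); first exact: bounded_finite_support0.
  by apply/funext => x; rewrite big_ord0.
under eq_fun do rewrite big_ord_recr/= -[X in X + _]mul1r.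
by apply: bounded_finite_support_lin => //; exact: IHn.
Qed.

(** Domination: [|f| ^ alpha] is at most [|K| ^ alpha] on [A] and vanishes off it, as
    [alpha > 0]. *)
Lemma bounded_finite_support_Lfun (alpha : R) f : 0 < alpha ->
  bounded_finite_support f -> f \in Lfun m alpha%:E.
Proof.
move=> a0 [mf [A [K [mA fA fK]]]].
apply/andP; split; rewrite inE//= /finite_norm unlock /Lnorm.
suff fin : (\int[m]_x (`|f x| `^ alpha)%:E < +oo)%E by exact: poweR_lty fin.
apply: (@le_lt_trans _ _ (\int[m]_x ((`|K| `^ alpha)%:E * (\1_A x)%:E))%E).
  apply: ge0_le_integral => //.
  - apply/measurable_EFinP.
    apply: (measurableT_comp (measurable_powR alpha)).
    exact: measurableT_comp.
  - by apply/measurable_EFinP/measurable_funM => //; exact: measurable_indic.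
  - move=> x _; rewrite /= lee_fin.
    have := fK x; rewrite indicE; case: (_ \in _); rewrite ?mulr1 ?mulr0 => h.
      apply: ge0_ler_powR; rewrite ?nnegrE//; first exact: ltW.
      by rewrite (le_trans h)// ler_norm.
    have -> : `|f x| = 0 by apply/eqP; rewrite eq_le h/=.
    by rewrite powR0 ?gt_eqF.
rewrite ge0_integralZl//; last exact/measurable_EFinP/measurable_indic.
rewrite integral_indic// setIT.
by apply: lte_mul_pinfty => //; rewrite lee_fin powR_ge0.
Qed.

Context d' (T : measurableType d') (P : probability T R) (alpha : R).
Variables (M : set E -> {RV P >-> R}) (I : (E -> R) -> {RV P >-> R}).
Hypotheses (alpha_gt0 : 0 < alpha) (I_integral : SaS_integral m alpha M I).

(** Each use of linearity costs a null set; finitely many are discarded. *)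
Lemma SaS_integral_sum n (theta : 'I_n -> R) (f : 'I_n -> E -> R) :
  (forall i, bounded_finite_support (f i)) ->
  {ae P, forall w, I (fun x => \sum_i theta i * f i x) w =
                   \sum_i theta i * I (f i) w}.
Proof.
elim: n theta f => [|n IHn] theta f bf.
  have L0 := bounded_finite_support_Lfun alpha_gt0 bounded_finite_support0.
  (* Zero coefficients yield [I 0 = 0] almost surely, for the empty sum. *)
  have := SaS_integral_linear I_integral 0 0 L0 L0.
  apply: filterS => w; rewrite !mul0r addr0 big_ord0 => I0.
  transitivity (I (fun x => 0 * cst 0 x + 0 * cst 0 x) w); last exact: I0.
  by congr (I _ w); apply/funext => x; rewrite big_ord0 !mul0r addr0.
have L1 := bounded_finite_support_Lfun alpha_gt0 (bounded_finite_support_sum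
  (theta \o widen_ord (leqnSn n)) (fun i => bf (widen_ord (leqnSn n) i))).
have L2 := bounded_finite_support_Lfun alpha_gt0 (bf ord_max).
have := SaS_integral_linear I_integral 1 (theta ord_max) L1 L2.
have := IHn (theta \o widen_ord (leqnSn n)) _
  (fun i => bf (widen_ord (leqnSn n) i)).
apply: filterS2 => w IHw; rewrite big_ord_recr/= mul1r IHw => <-.
by congr (I _ w); apply/funext => x; rewrite big_ord_recr/= mul1r.
Qed.

Lemma char_fun_ae_eq (X : {RV P >-> R}) (Z : T -> R) theta :
  measurable_fun setT Z -> {ae P, forall w, X w = Z w} ->
  char_fun P Z theta = char_fun P X theta.
Proof.
move=> mZ XZ; rewrite /char_fun /Rintegral.
have h (g : R -> R) : continuous g ->
    (\int[P]_w (g (theta * Z w))%:E = \int[P]_w (g (theta * X w))%:E)%E.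
  move=> cg; apply: ae_eq_integral => //.
  - apply/measurable_EFinP; apply: (measurableT_comp (continuous_measurable_fun cg)).
    exact: measurable_funM.
  - apply/measurable_EFinP; apply: (measurableT_comp (continuous_measurable_fun cg)).
    exact: measurable_funM.
  - by apply: filterS XZ => w + _ => ->.
by rewrite (h cos (@continuous_cos R)) (h sin (@continuous_sin R)).
Qed.

(** Almost surely the combination is the integral of the combined integrand, whose law is
    prescribed. *)
Lemma char_fun_SaS_integral_sum n (theta : 'I_n -> R) (f : 'I_n -> E -> R) :
  (forall i, bounded_finite_support (f i)) ->
  char_fun P (fun w => \sum_i theta i * I (f i) w) 1 =
  (expR (- \int[m]_x (`|\sum_i theta i * f i x| `^ alpha)))%:C%C.
Proof.
move=> bf; have [mS _] := bounded_finite_support_sum theta bf.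
rewrite (@char_fun_ae_eq (I (fun x => \sum_i theta i * f i x))).
- rewrite (SaS_integral_law I_integral).
    by rewrite normr1 powR1 mul1r.
  exact/bounded_finite_support_Lfun/bounded_finite_support_sum.
- by apply: measurable_sum => i; exact: measurable_funM.
- exact: SaS_integral_sum.
Qed.

End integral_of_linear_combinations.

(** * Self-similarity by comparison of exponents *)

Theorem proposition1 (R : realType) (alpha beta : R)
    (alpha_gt0 : 0 < alpha) (alpha_lt2 : alpha < 2)
    (beta_gt0 : 0 < beta) (beta_lt1 : beta < 1)
    (d' : measure_display) (Omega' : measurableType d')
    (P' : probability Omega' R)
    (N : R -> {RV P' >-> nat}) (N_Poisson : standard_Poisson_process N)
    (d : measure_display) (Omega : measurableType d)
    (P : probability Omega R)
    (M : set (R * Omega') -> {RV P >-> R})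
    (M_SaS : SaS_random_measure (control_measure P' beta_gt0) alpha M)
    (I : (R * Omega' -> R) -> {RV P >-> R})
    (I_integral : SaS_integral (control_measure P' beta_gt0) alpha M I) :
  self_similar P (beta / alpha) (U_process N I).
Proof.
move=> l l0 n t t0 B mB; rewrite /U_process.
have bO s : 0 <= s ->
    bounded_finite_support (control_measure P' beta_gt0) \1_(odd_occupancy N s).
  move=> s0; apply: bounded_finite_support_indic.
    exact: measurable_odd_occupancy.
  exact: control_measure_odd_occupancy_lty.
apply: (@Cramer_Wold _ _ _ _ P
  (fun i => I \1_(odd_occupancy N (l * t i)) : Omega -> R)
  (fun i w => l `^ (beta / alpha) * I \1_(odd_occupancy N (t i)) w)) => //.
  by move=> i; exact: measurable_funM.
move=> theta.
(* The factor [l ^ (beta / alpha)] joins the coefficients, so one formula covers both sides. *)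
under [in RHS]eq_fun do under eq_bigr do rewrite mulrA.
rewrite !(char_fun_SaS_integral_sum alpha_gt0 I_integral); first last.
- by move=> i; apply: bO; rewrite mulr_ge0// ltW.
- by move=> i; apply: bO; exact: t0.
apply: (congr1 (fun v => (expR (- v))%:C%C)).
rewrite /Rintegral; apply: (congr1 fine).
pose h (x : R * Omega') :=
  (`|\sum_i theta i * \1_(odd_occupancy N (t i)) x| `^ alpha)%:E.
have h0 x : (0 <= h x)%E by rewrite lee_fin powR_ge0.
have mh : measurable_fun setT h.
  apply/measurable_EFinP; apply: (measurableT_comp (measurable_powR alpha)).
  apply: measurableT_comp => //.
  by have [] := bounded_finite_support_sum theta (fun i => bO _ (t0 i)).
(* Both exponents equal [l ^ beta] times the integral of [h]; on the left by dilating the radius. *)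
transitivity ((l `^ beta)%:E * \int[control_measure P' beta_gt0]_x h x)%E.
  rewrite -(ge0_integral_controlZ P' beta_gt0 l0 mh h0).
  apply: eq_integral => x _; rewrite /h.
  by under eq_bigr do rewrite odd_occupancyM//.
(* On the right, [l ^ (beta / alpha)] leaves the absolute value and becomes [l ^ beta] under the
   power [alpha]. *)
rewrite -(ge0_integralZl (control_measure P' beta_gt0) measurableT mh
  (fun x _ => h0 x)); last by rewrite lee_fin powR_ge0.
apply: eq_integral => x _; rewrite /h -EFinM; apply: (congr1 EFin).
have -> : \sum_i theta i * l `^ (beta / alpha) * \1_(odd_occupancy N (t i)) x =
    l `^ (beta / alpha) * \sum_i theta i * \1_(odd_occupancy N (t i)) x.
  by rewrite mulr_sumr; apply: eq_bigr => i _; rewrite mulrCA mulrA.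
rewrite normrM powRM// ger0_norm ?powR_ge0// -powRrM divfK//.
by rewrite gt_eqF.
Qed.
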